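(* Let $\mathcal{G}$ be a finite stochastic game with vertex set $V$, let $\Omega_1:V\to\{0,1\}$ (a coBüchi condition) and $\Omega_2:V\to\mathbb{N}$. If Player 1 has a strategy from a vertex $v$ that is sure winning for $\mathsf{Parity}(\Omega_1)$ and almost-sure winning for $\mathsf{Parity}(\Omega_2)$, then Player 1 has a memoryless such strategy from $v$.
   Context: A stochastic game $\langle V,(V_1,V_2,V_\Diamond),E,\delta\rangle$ has a finite vertex set $V$ partitioned into Player-1, Player-2 and probabilistic vertices, edges $E\subseteq V\times V$ with every vertex having a successor, and $\delta:V_\Diamond\to\mathcal{D}(V)$ giving for each probabilistic vertex a distribution whose support is exactly its successor set. A strategy for Player $i$ maps histories (finite paths) ending in $V_i$ to a successor of the last vertex; it is memoryless if its choice depends only on the last vertex of the history. $\mathsf{Out}(v,\sigma_1)$ is the set of plays from $v$ consistent with $\sigma_1$, and $\mathsf{Pr}_v^{\sigma_1,\sigma_2}$ is the induced probability measure. $\mathsf{Parity}(\Omega)$ is the set of plays $v_0v_1\dots$ with $\limsup_j\Omega(v_j)$ even (for $\Omega$ into $\{0,1\}$ this means priority 1 is visited only finitely often). $\sigma_1$ is sure winning for $\psi$ from $v$ if $\mathsf{Out}(v,\sigma_1)\subseteq\psi$, and almost-sure winning if $\mathsf{Pr}_v^{\sigma_1,\sigma_2}(\psi)=1$ for all Player-2 strategies $\sigma_2$. *)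

(* Defs.v *)
From HB Require Import structures.
From mathcomp Require Import all_boot all_order all_algebra.
From mathcomp Require Import all_classical all_reals all_analysis.
Set Implicit Arguments. Unset Strict Implicit. Unset Printing Implicit Defensive.
Import Order.TTheory GRing.Theory Num.Theory.
Local Open Scope classical_set_scope.
Local Open Scope ring_scope.

Inductive owner := Pl1 | Pl2 | Prob.

Record game (R : realType) (V : finType) := Game {
  own : V -> owner;
  edge : rel V;
  edge_total : forall v, exists w, edge v w;
  delta : V -> V -> R;
  delta_ge0 : forall v w, own v = Prob -> 0 <= delta v w;
  delta_sum1 : forall v, own v = Prob -> \sum_(w : V) delta v w = 1;
  delta_supp : forall v w, own v = Prob -> (0 < delta v w <-> edge v w)
}.

Section Games.
Variables (R : realType) (V : finType) (G : game R V).

(* A history (finite path) is represented as (h, u): the vertices h visited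
   before, followed by the last vertex u.  A strategy maps it to a vertex. *)
Definition strategy := seq V -> V -> V.

(* sigma is a strategy for Player i: on histories ending in V_i it picks a
   successor of the last vertex (values elsewhere are irrelevant). *)
Definition is_strategy (i : owner) (sigma : strategy) :=
  forall h u, own G u = i -> edge G u (sigma h u).

Definition memoryless (i : owner) (sigma : strategy) :=
  forall h h' u, own G u = i -> sigma h u = sigma h' u.

Definition play := nat -> V.

Definition prefix (rho : play) (n : nat) : seq V := [seq rho k | k <- iota 0 n].

Definition Out (v : V) (sigma1 : strategy) : set play :=
  [set rho | rho 0%N = v /\
     forall n, edge G (rho n) (rho n.+1) /\
       (own G (rho n) = Pl1 -> rho n.+1 = sigma1 (prefix rho n) (rho n))].

(* Parity(Omega): limsup_j Omega(v_j) is even.  For a bounded nat sequence the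
   limsup is the value p occurring infinitely often and eventually bounding
   the sequence from above. *)
Definition Parity (Omega : V -> nat) : set play :=
  [set rho | exists p : nat, ~~ odd p /\
     (forall N, exists2 n, (N <= n)%N & Omega (rho n) = p) /\
     (exists N, forall n, (N <= n)%N -> (Omega (rho n) <= p)%N)].

Definition cylinder (h : seq V) : set play :=
  [set rho | forall i, (i < size h)%N -> rho i = nth (rho i) h i].

Definition cylinders : set (set play) := [set cylinder h | h in setT].

Definition is_probability (P : set play -> \bar R) :=
  [/\ P set0 = 0%E,
      (forall A, <<s cylinders >> A -> (0 <= P A)%E),
      (forall F : nat -> set play, (forall n, <<s cylinders >> (F n)) ->
          trivIset setT F ->
          (fun n => \sum_(0 <= i < n) P (F i))%E @ \oo --> P (\bigcup_n F n))
    & P setT = 1%E].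

Definition step_prob (sigma1 sigma2 : strategy) (h : seq V) (u w : V) : R :=
  match own G u with
  | Pl1 => (sigma1 h u == w)%:R
  | Pl2 => (sigma2 h u == w)%:R
  | Prob => delta G u w
  end.

Definition path_prob (v : V) (sigma1 sigma2 : strategy) (h : seq V) : R :=
  match h with
  | [::] => 1
  | u0 :: _ => (u0 == v)%:R *
      \prod_(i < (size h).-1)
         step_prob sigma1 sigma2 (take i h) (nth u0 h i) (nth u0 h i.+1)
  end.

(* P is the measure Pr_v^{sigma1,sigma2} induced by the strategies: a
   probability measure on the cylinder sigma-algebra with the prescribed
   values on cylinders (it exists and is unique by Caratheodory /
   Ionescu-Tulcea). *)
Definition induced_measure (v : V) (sigma1 sigma2 : strategy)
    (P : set play -> \bar R) :=
  is_probability P /\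
  forall h, P (cylinder h) = (path_prob v sigma1 sigma2 h)%:E.

Definition sure_winning (sigma1 : strategy) (psi : set play) (v : V) :=
  Out v sigma1 `<=` psi.

Definition almost_sure_winning (sigma1 : strategy) (psi : set play) (v : V) :=
  forall sigma2, is_strategy Pl2 sigma2 ->
  forall P, induced_measure v sigma1 sigma2 P -> P psi = 1%E.

End Games.

(* Main.v *)
Require Import Defs.
From HB Require Import structures.
From mathcomp Require Import all_boot all_order all_algebra.
From mathcomp Require Import all_classical all_reals all_analysis.
From mathcomp Require Import zify.
Set Implicit Arguments. Unset Strict Implicit. Unset Printing Implicit Defensive.
Import Order.TTheory GRing.Theory Num.Theory.

(** Call a play fair if it takes infinitely often every edge leaving a
probabilistic vertex that it visits infinitely often.  Under any pair of
strategies almost every play is fair, so a positional strategy whose fair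
outcomes all satisfy the parity condition wins almost surely, and only
nonrandom games on fair plays remain.

By induction on the arena X, either player i has a positional strategy winning
all fair plays in X, or the opponent has one on a nonempty set Y that the
others cannot leave: play towards the vertices of maximal priority on their
attractor (with probabilistic vertices helping) and recurse on the complement.

Now let X be a maximal set on which a positional strategy of Player 1 satisfies
both conditions.  Suppose that v is not in X and take the given strategy from
v.  From a history ending outside X, if the bad priority 1 of Omega1 cannot be
reached outside X, consider the set Z of vertices reachable outside X: by the
dichotomy for Z minus the attractor of X, either Z can be added to X, or
Player 2 refutes almost-sure winning with positive probability by steering into
a set Y as above.  Hence the bad priority can be reached again and again, and
the given strategy is not sure winning. *)

(** * Positional strategies on fair plays *)

Section InfinitelyOften.

Definition infinitely_often (P : nat -> Prop) :=
  forall N, exists2 n, (N <= n)%N & P n.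

Lemma infinitely_often_sub (P Q : nat -> Prop) :
  (forall n, P n -> Q n) -> infinitely_often P -> infinitely_often Q.
Proof. by move=> PQ Pinf N; have [n Nn /PQ] := Pinf N; exists n. Qed.

Lemma not_infinitely_often (P : nat -> Prop) :
  ~ infinitely_often P -> exists N, forall n, (N <= n)%N -> ~ P n.
Proof.
move=> Pfin; apply: contrapT => nP; apply: Pfin => N.
by apply: contrapT => nn; apply: nP; exists N => n Nn Pn; apply: nn; exists n.
Qed.

Lemma infinitely_often_pigeonhole (T : finType) (f : nat -> T) P :
  infinitely_often P -> exists x, infinitely_often (fun n => P n /\ f n = x).
Proof.
move=> Pinf; apply: contrapT => nex.
have /choice[N HN] : forall x, exists N, forall n,
    (N <= n)%N -> ~ (P n /\ f n = x).
  by move=> x; apply: not_infinitely_often => Px; apply: nex; exists x.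
have [n Nn Pn] := Pinf (\max_x N x).
by apply: (HN (f n) n) => //; apply: leq_trans Nn; apply: leq_bigmax.
Qed.

End InfinitelyOften.

Lemma maximal_set_exists (V : finType) (P : {set V} -> Prop) A0 :
  P A0 -> exists2 A, P A & forall B : {set V}, A \proper B -> ~ P B.
Proof.
move=> PA0.
have [|A /maxsetP[/asboolP PA maxA]] := @ex_maxset V (fun A => `[< P A >]).
  by exists A0; apply/asboolP.
exists A => // B AB /asboolP PB; have := maxA B PB (proper_sub AB).
by move=> BA; move: AB; rewrite BA => /properP[_ [x ->]].
Qed.

Section FairGames.
Variables (R : realType) (V : finType) (G : game R V) (Omega : V -> nat).
Implicit Types (X Y A T : {set V}) (rho : play V) (i : bool) (s : V -> V).
Implicit Types (r : V -> nat).

(** Players are booleans, [true] for Player 1, so that the opponent of [i] is [~~ i] and the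
    recursion can exchange the roles. *)
Definition player i u := own G u = if i then Pl1 else Pl2.

Lemma player_or_prob i u :
  [\/ player i u, player (~~ i) u | own G u = Prob].
Proof.
rewrite /player; case: (own G u); case: i => /=;
  by [constructor 1 | constructor 2 | constructor 3].
Qed.

Lemma prob_not_player i u : own G u = Prob -> ~ player i u.
Proof. by rewrite /player => ->; case: i. Qed.

Definition wins_parity i rho := exists p : nat, odd p = ~~ i /\
  infinitely_often (fun n => Omega (rho n) = p) /\
  exists N, forall n, (N <= n)%N -> (Omega (rho n) <= p)%N.

Lemma wins_parity_true rho : wins_parity true rho <-> Parity Omega rho.
Proof.
by split=> -[p [/= p_even H]]; exists p; split=> //;
  [rewrite p_even | apply/negbTE].
Qed.

Lemma wins_parity_unique rho :
  wins_parity true rho -> wins_parity false rho -> False.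
Proof.
move=> [p [pe [pinf [N pN]]]] [q [qo [qinf [M qM]]]].
have [n Mn np] := pinf M; have [m Nm mq] := qinf N.
have pq : p = q by apply/eqP; rewrite eqn_leq -{1}np qM // -mq pN.
by move: pe; rewrite pq qo.
Qed.

Definition tail (N : nat) rho : play V := fun n => rho (N + n)%N.

Lemma tail_infinitely_often N (P : nat -> Prop) :
  infinitely_often P <-> infinitely_often (fun n => P (N + n)%N).
Proof.
split=> Pinf M; have [n Mn Pn] := Pinf (N + M)%N.
  by exists (n - N)%N; [lia | rewrite subnKC //; lia].
by exists (N + n)%N; first lia.
Qed.

Lemma tail_wins_parity N i rho : wins_parity i (tail N rho) -> wins_parity i rho.
Proof.
move=> [p [pi [pinf [M pM]]]]; exists p; split=> //; split.
  by apply/(tail_infinitely_often N).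
exists (N + M)%N => n Mn; have := pM (n - N)%N; rewrite /tail subnKC; last lia.
by apply; lia.
Qed.

Definition fair rho := forall u w, own G u = Prob -> edge G u w ->
  infinitely_often (fun n => rho n = u) ->
  infinitely_often (fun n => rho n = u /\ rho n.+1 = w).

Lemma tail_fair N rho : fair rho -> fair (tail N rho).
Proof.
move=> rhoF u w uP uw uinf.
have := rhoF u w uP uw ((tail_infinitely_often N (fun n => rho n = u)).2 uinf).
move/(tail_infinitely_often N); apply: infinitely_often_sub => n.
by rewrite /tail addnS.
Qed.

(** Probabilistic vertices keep all their successors, so fairness in [G] retains its meaning inside
    the subgame. *)
Definition arena X := forall u, u \in X ->
  (exists2 w, w \in X & edge G u w) /\
  (own G u = Prob -> forall w, edge G u w -> w \in X).

(* Everyone except player i is forced to stay in Y as long as the play stays in X. *)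
Definition trap i Y X := forall u w, u \in Y -> ~ player i u ->
  w \in X -> edge G u w -> w \in Y.

Definition moves_in i X s := forall u, u \in X -> player i u ->
  edge G u (s u) /\ s u \in X.

Definition play_in i X s rho := forall n,
  [/\ rho n \in X, edge G (rho n) (rho n.+1)
    & player i (rho n) -> rho n.+1 = s (rho n)].

(** Only plays that remain in [X] are judged; that the others cannot leave it is stated separately
    by [trap]. *)
Definition wins i X s := moves_in i X s /\
  forall rho, play_in i X s rho -> fair rho -> wins_parity i rho.

Lemma trap_trans i Z Y X : trap i Z Y -> trap i Y X -> Z \subset Y -> trap i Z X.
Proof.
move=> tZ tY /fintype.subsetP ZY u w uZ iu wX uw; apply: tZ (uw) => //.
exact: tY (ZY u uZ) iu wX uw.
Qed.

(** * Attractors *)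

Definition approaches A r u w := [/\ edge G u w, w \in A & (r w < r u)%N].

Definition attracted i X T A r s := forall u, u \in A -> u \notin T ->
  [/\ player i u -> approaches A r u (s u),
      own G u = Prob -> exists w, approaches A r u w
    & player (~~ i) u -> forall w, w \in X -> edge G u w -> approaches A r u w].

(* The attractor is a maximal set carrying a rank that player i decreases
   with positive probability. *)
Lemma attractor_exists i X T : arena X -> T \subset X ->
  exists A r s, [/\ T \subset A, A \subset X, attracted i X T A r s,
    arena (X :\: A) & trap (~~ i) (X :\: A) X].
Proof.
move=> aX TX.
have [|A [TA AX [r [s att]]] maxA] := @maximal_set_exists V
    (fun A => [/\ T \subset A, A \subset X & exists r s, attracted i X T A r s]) T.
  by split=> //; exists (fun=> 0%N), id => u ->.
(* [m] exceeds every rank in [A]; it is the rank given to a vertex that would be added. *)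
pose m := (\max_(w in A) r w).+1.
have rm w : w \in A -> (r w < m)%N by move=> wA; rewrite ltnS (leq_bigmax_cond w).
have noext u : u \in X -> u \notin A -> (exists2 w, w \in A & edge G u w) ->
    (player (~~ i) u -> forall w, w \in X -> edge G u w -> w \in A) -> False.
  move=> uX uA [w0 w0A uw0] uall.
  apply: (maxA (u |: A)).
    by rewrite properE finset.subsetUr finset.subUset finset.sub1set negb_and uA.
  split; [by apply/finset.subsetU; rewrite TA orbT | by rewrite finset.subUset finset.sub1set uX |].
  exists (fun x => if x == u then m else r x), (fun x => if x == u then w0 else s x).
  have nu w : w \in A -> (w == u) = false.
    by move=> wA; apply: contraNF uA => /eqP <-.
  have appr w : w \in A -> edge G u w ->
      approaches (u |: A) (fun x => if x == u then m else r x) u w.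
    by move=> wA uw; split; rewrite // ?finset.in_setU1 ?wA ?orbT // eqxx nu // rm.
  move=> x; rewrite finset.in_setU1; case: eqVneq => [-> _ _|xu /= xA xT].
    by split=> [_|_|ju w wX uw]; [exact: appr | exists w0; exact: appr
      | by apply: appr => //; apply: uall].
  have lift w : approaches A r x w ->
      approaches (u |: A) (fun x => if x == u then m else r x) x w.
    by case=> xw wA rw; split; rewrite // ?finset.in_setU1 ?wA ?orbT // (negbTE xu) nu.
  have [a1 a2 a3] := att x xA xT; split=> [/a1/lift//|/a2[w /lift]|/a3 H w wX xw].
    by exists w.
  by apply: lift; apply: H.
have tC : trap (~~ i) (X :\: A) X.
  move=> u w; rewrite !inE => /andP[uA uX] ju wX uw; rewrite wX andbT.
  by apply/negP => wA; apply: (noext u) => //; exists w.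
exists A, r, s; split=> // u; rewrite inE => /andP[uA uX].
have uC : u \in X :\: A by rewrite inE uA.
have [[w wX uw] uP] := aX u uX; split=> [|pu x ux]; last first.
  by apply: tC uC _ (uP pu _ ux) ux; apply: prob_not_player.
have [ju|nju] := pselect (player (~~ i) u); last by exists w => //; apply: tC uw.
(* An opponent's vertex without successor in [X :\: A] has all its successors within [X] in [A],
   hence could be added. *)
apply: contrapT => nex; apply: (noext u) => //.
  exists w => //; apply: contrapT => /negP wA.
  by apply: nex; exists w; rewrite // inE wA.
move=> _ x xX ux; apply: contrapT => /negP xA.
by apply: nex; exists x; rewrite // inE xA.
Qed.

(* By fairness, a play visiting the attractor infinitely often visits the
   target infinitely often: the least rank seen infinitely often is that of a target. *)
Lemma fair_attracted i X T A r s rho :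
  attracted i X T A r s -> fair rho ->
  (forall n, rho n \in X /\ edge G (rho n) (rho n.+1)) ->
  (forall n, rho n \in A -> rho n \notin T -> player i (rho n) ->
     rho n.+1 = s (rho n)) ->
  infinitely_often (fun n => rho n \in A) ->
  infinitely_often (fun n => rho n \in T).
Proof.
move=> att rhoF rhoX rhos.
move=> /(infinitely_often_pigeonhole rho)[u0 u0inf].
have u0A : u0 \in A by have [n _ [nA <-]] := u0inf 0%N.
have {}u0inf : infinitely_often (fun n => rho n = u0).
  by apply: infinitely_often_sub u0inf => n [].
elim: {u0}(r u0).+1 {-2}u0 (ltnSn (r u0)) u0A u0inf => // k IH u rk uA uinf.
have [uT|uT] := boolP (u \in T).
  by apply: infinitely_often_sub uinf => n ->.
(* If every such visit is followed by an approaching move, a single successor of smaller rank recurs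
   infinitely often. *)
have next (P : nat -> Prop) : infinitely_often P ->
    (forall n, P n -> approaches A r u (rho n.+1)) ->
    infinitely_often (fun n => rho n \in T).
  move=> /(infinitely_often_pigeonhole (fun n => rho n.+1))[w winf] Pw.
  have [n0 _ [/Pw aw ew]] := winf 0%N; move: aw; rewrite ew => -[uw wA rw].
  apply: (IH w) => //; first by apply: leq_trans rw _.
  apply/(tail_infinitely_often 1); apply: infinitely_often_sub winf => n [_ <-].
  by rewrite add1n.
have [a1 a2 a3] := att u uA uT.
have [iu|ju|pu] := player_or_prob i u.
- apply: next uinf _ => n nu; have := rhos n; rewrite nu => -> //.
  exact: a1.
- apply: next uinf _ => n nu; apply: a3 => //; first by have [] := rhoX n.+1.
  by have [_] := rhoX n; rewrite nu.
(* Fairness is used here: the edge of decreasing rank is taken infinitely often. *)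
have [w aw] := a2 pu; have [uw _ _] := aw.
by apply: next (rhoF u w pu uw uinf) _ => n [_ ->].
Qed.

(** A play seeing [T] infinitely often wins by hypothesis. Any other fair play sees [A] only
    finitely often by [fair_attracted], so a tail of it lies in [X :\: A] and follows [sC]. *)
Lemma attractor_wins i X T A r s sT sC :
  T \subset A -> A \subset X -> attracted i X T A r s ->
  wins i (X :\: A) sC ->
  (forall u, u \in T -> player i u -> edge G u (sT u) /\ sT u \in X) ->
  (forall rho, (forall n, [/\ rho n \in X, edge G (rho n) (rho n.+1) &
       rho n \in T -> player i (rho n) -> rho n.+1 = sT (rho n)]) ->
     fair rho -> infinitely_often (fun n => rho n \in T) -> wins_parity i rho) ->
  wins i X (fun u => if u \in T then sT u else if u \in A then s u else sC u).
Proof.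
move=> TA /fintype.subsetP AX att [mC winC] mT winT; split.
  move=> u uX iu; have [uT|uT] := ifPn; first exact: mT.
  have [uA|uA] := ifPn.
    by have [/(_ iu)[? /AX]] := att u uA uT.
  have uC : u \in X :\: A by rewrite inE uA.
  by have [? ] := mC u uC iu; rewrite inE => /andP[].
move=> rho rhoX rhoF.
have rhoX' n : rho n \in X /\ edge G (rho n) (rho n.+1) by have [] := rhoX n.
have [Tinf|Tfin] := pselect (infinitely_often (fun n => rho n \in T)).
  by apply: winT => // n; have [? ? H] := rhoX n; split=> // nT /H; rewrite nT.
have Afin : ~ infinitely_often (fun n => rho n \in A).
  move=> Ainf; apply: Tfin; apply: fair_attracted att _ _ _ Ainf => // n nA nT.
  by have [_ _ H] := rhoX n => /H; rewrite (negbTE nT) nA.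
have [N HN] := not_infinitely_often Afin.
apply: (@tail_wins_parity N); apply: winC; last exact: tail_fair.
move=> n; rewrite /tail addnS; have [nX ne H] := rhoX (N + n)%N.
have /negP nA := HN (N + n)%N (leq_addr _ _).
split=> //; first by rewrite inE nA.
have nT : rho (N + n)%N \notin T by apply: contraNN nA => /(fintype.subsetP TA).
by move=> /H; rewrite (negbTE nA) (negbTE nT).
Qed.

(** A play that enters [T] stays there, by [trap] and the moves of [sT], and its tail wins. *)
Lemma attractor_wins_trap i X T A r s sT sC :
  arena X -> T \subset A -> A \subset X -> attracted i X T A r s ->
  trap i T X -> wins i T sT -> wins i (X :\: A) sC ->
  wins i X (fun u => if u \in T then sT u else if u \in A then s u else sC u).
Proof.
move=> aX TA AX att tT [mT wT] winC.
have TX := fintype.subset_trans TA AX.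
apply: (attractor_wins TA AX att winC) => [u uT iu|rho rhoX rhoF Tinf].
  by have [? /(fintype.subsetP TX)] := mT u uT iu.
have [N _ NT] := Tinf 0%N.
apply: (@tail_wins_parity N); apply: wT; last exact: tail_fair.
have inT n : rho (N + n)%N \in T.
  elim: n => [|n IH]; first by rewrite addn0.
  rewrite addnS; have [nX ne H] := rhoX (N + n)%N.
  have [iu|niu] := pselect (player i (rho (N + n)%N)).
    by rewrite H //; have [] := mT _ IH iu.
  by apply: tT IH niu _ ne; have [] := rhoX (N + n).+1.
move=> n; rewrite /tail addnS; have [nX ne H] := rhoX (N + n)%N.
by split=> //; apply: H.
Qed.

(** Seeing the top priority [d] infinitely often decides the play, so on [T] any move that remains
    in [X] will do. *)
Lemma attractor_wins_top i X T A r s sC d :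
  arena X -> T = [set u in X | Omega u == d] ->
  (forall u, u \in X -> Omega u <= d)%N -> odd d = ~~ i ->
  T \subset A -> A \subset X -> attracted i X T A r s ->
  wins i (X :\: A) sC -> exists sX, wins i X sX.
Proof.
move=> aX defT Xd di TA AX att winC.
have /choice[sT HsT] : forall u, exists w, u \in X -> w \in X /\ edge G u w.
  move=> u; have [uX|] := boolP (u \in X); last by exists u.
  by have [[w wX uw] _] := aX u uX; exists w.
exists (fun u => if u \in T then sT u else if u \in A then s u else sC u).
apply: (attractor_wins TA AX att winC) => [u uT _|rho rhoX rhoF Tinf].
  by have [] := HsT u (fintype.subsetP (fintype.subset_trans TA AX) u uT).
exists d; split=> //; split.
  by apply: infinitely_often_sub Tinf => n; rewrite defT inE => /andP[_ /eqP].
by exists 0%N => n _; apply: Xd; have [] := rhoX n.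
Qed.

(** Zielonka's recursion on the size of [X], restricted to fair plays; [trap_trans] carries a trap
    found in a subarena back to [X]. *)
Lemma parity_dichotomy i X : arena X ->
  (exists s, wins i X s) \/
  (exists Y s, [/\ Y != finset.set0, Y \subset X, trap (~~ i) Y X & wins (~~ i) Y s]).
Proof.
elim: {X}#|X|.+1 {-2}X (ltnSn #|X|) i => // n IH X Xn i aX.
have [X0|/finset.set0Pn[x0 x0X]] := eqVneq X finset.set0.
  left; exists id; split=> [u|rho]; first by rewrite X0 inE.
  by move=> /(_ 0%N)[]; rewrite X0 inE.
pose x := [arg max_(y > x0 in X) Omega y].
have [xX xmax] : x \in X /\ forall u, u \in X -> (Omega u <= Omega x)%N.
  by rewrite /x; case: arg_maxnP => //.
pose D := [set u in X | Omega u == Omega x].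
have xD : x \in D by rewrite inE xX eqxx.
have DX : D \subset X by apply/fintype.subsetP => u; rewrite inE => /andP[].
have smaller A y : A \subset X -> y \in A -> (#|X :\: A| < n)%N.
  move=> AX yA; rewrite -ltnS; apply: leq_trans Xn; rewrite ltnS.
  apply: proper_card; apply/properP; split; first exact: finset.subsetDl.
  by exists y; [exact: (fintype.subsetP AX) | rewrite inE yA].
(* Recursion for [i] outside its own attractor: a solution there extends to [X] by [winC], and a set
   won there by the opponent is already one for [X]. *)
have step T A : T \subset A -> A \subset X -> T != finset.set0 -> arena (X :\: A) ->
    trap (~~ i) (X :\: A) X ->
    (forall sC, wins i (X :\: A) sC -> exists s, wins i X s) ->
    (exists s, wins i X s) \/
    (exists Y s, [/\ Y != finset.set0, Y \subset X, trap (~~ i) Y X & wins (~~ i) Y s]).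
  move=> TA AX /finset.set0Pn[y yT] aC tC winC.
  have [[sC /winC]|[Y [s [Y0 YC tY wY]]]] :=
    IH (X :\: A) (smaller A y AX (fintype.subsetP TA y yT)) i aC; first by left.
  right; exists Y, s; split=> //; first by apply: fintype.subset_trans YC (finset.subsetDl _ _).
  exact: trap_trans tY tC YC.
have [di|di] := eqVneq (odd (Omega x)) (~~ i).
  have [A [r [s [DA AX att aC tC]]]] := attractor_exists i aX DX.
  apply: (step D A) => //; first by apply/finset.set0Pn; exists x.
  by move=> sC; apply: attractor_wins_top att.
have {}di : odd (Omega x) = ~~ ~~ i by move: di; case: (odd _); case: (i).
(* The top priority favours the opponent, whose attractor is removed first. If the opponent wins the
   rest, it wins all of [X]; otherwise [i] wins a nonempty trap [Y]. *)
have [A [r [s [DA AX att aC tC]]]] := attractor_exists (~~ i) aX DX.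
have [[sC wC]|[Y [sY [Y0 YC tY wY]]]] :=
  IH (X :\: A) (smaller A x AX (fintype.subsetP DA x xD)) (~~ i) aC.
  right; have [sX wX] := attractor_wins_top aX erefl xmax di DA AX att wC.
  exists X, sX; split=> //; first by apply/finset.set0Pn; exists x.
rewrite negbK in tC tY wY.
have YX : Y \subset X by apply: fintype.subset_trans YC (finset.subsetDl _ _).
have {}tY := trap_trans tY tC YC.
(* Now [i] attracts to [Y], and the recursion continues on what remains. *)
have [A' [r' [s' [YA' A'X att' aC' tC']]]] := attractor_exists i aX YX.
apply: (step Y A') => // sC wC.
exists (fun u => if u \in Y then sY u else if u \in A' then s' u else sC u).
exact: (attractor_wins_trap aX YA' A'X att' tY wY wC).
Qed.

End FairGames.

(** * Sure coBuchi and fair parity *)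

Section SureCoBuchi.
Variables (R : realType) (V : finType) (G : game R V).
Variables (Omega1 Omega2 : V -> nat) (v : V) (sigma1 : strategy V).
Implicit Types (X Y : {set V}) (rho : play V) (s : V -> V) (h : seq V).

Lemma prefixS rho n : Defs.prefix rho n.+1 = rcons (Defs.prefix rho n) (rho n).
Proof. by rewrite /Defs.prefix -addn1 iotaD map_cat cats1. Qed.

(** The coBuchi condition is imposed on all plays in [X] and not just on the fair ones, since it
    must hold surely. *)
Definition solves X s :=
  [/\ trap G true X [set: V]%SET, wins G Omega2 true X s
    & forall rho, play_in G true X s rho ->
        ~ infinitely_often (fun n => Omega1 (rho n) <> 0%N)].

Definition solvable X := exists s, solves X s.

Lemma trap_play_in i X Y s s' rho N :
  trap G i X Y -> moves_in G i X s -> play_in G i Y s' rho ->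
  {in X, s =1 s'} -> rho N \in X -> play_in G i X s (tail N rho).
Proof.
move=> tX mX rhoY ss' NX.
have inX n : rho (N + n)%N \in X.
  elim: n => [|n IH]; first by rewrite addn0.
  rewrite addnS; have [nY ne H] := rhoY (N + n)%N.
  have [iu|niu] := pselect (player G i (rho (N + n)%N)).
    by rewrite H // -ss' //; have [] := mX _ IH iu.
  by apply: tX IH niu _ ne; have [] := rhoY (N + n).+1.
move=> n; rewrite /tail addnS; have [nX ne H] := rhoY (N + n)%N.
by split=> // /H ->; rewrite ss'.
Qed.

(** * Histories consistent with the given strategy *)

Definition move h u w := edge G u w /\ (own G u = Pl1 -> w = sigma1 h u).

Inductive reach X h0 u0 : seq V -> V -> Prop :=
| reach0 : reach X h0 u0 h0 u0
| reachS h u w : reach X h0 u0 h u -> move h u w -> w \notin X ->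
    reach X h0 u0 (rcons h u) w.

(** With the empty set nothing is avoided, so all histories from [v] consistent with [sigma1] are
    obtained. *)
Definition history := reach finset.set0 [::] v.

Lemma history_reach X h0 u0 h u :
  history h0 u0 -> reach X h0 u0 h u -> history h u.
Proof.
by move=> H; elim=> // {}h {}u w _ IH uw _; apply: reachS; rewrite // inE.
Qed.

Lemma reach_notin X h0 u0 h u : u0 \notin X -> reach X h0 u0 h u -> u \notin X.
Proof. by move=> u0X; elim. Qed.

(** The counter is the exact number of moves; its least value serves later as a distance to the bad
    priority. *)
Fixpoint bad_within X k h u : Prop :=
  if k is k'.+1 then
    exists w, [/\ move h u w, w \notin X & bad_within X k' (rcons h u) w]
  else Omega1 u <> 0%N.

Lemma reach_bad_within X h0 u0 h u k : reach X h0 u0 h u ->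
  bad_within X k h u -> exists j, bad_within X j h0 u0.
Proof.
move=> hu; elim: hu k => {h u}[|h u w _ IH uw wX] k bad; first by exists k.
by apply: (IH k.+1); exists w.
Qed.

(* No history can be continued by a positional Player-2 strategy against which
   every fair outcome violates Parity(Omega2). *)
Definition unrefuted := forall h y (tau : V -> V), history h y ->
  (forall u, own G u = Pl2 -> edge G u (tau u)) ->
  exists rho, [/\ fair G rho, Out G v sigma1 rho, Defs.prefix rho (size h) = h,
    rho (size h) = y & (forall n, (size h <= n)%N -> own G (rho n) = Pl2 ->
       rho n.+1 = tau (rho n)) /\ wins_parity Omega2 true rho].

Hypothesis sigma1_strat : is_strategy G Pl1 sigma1.
Hypothesis sigma1_unrefuted : unrefuted.

Lemma edge_choice : exists e : V -> V, forall u, edge G u (e u).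
Proof. by have /choice[e] := edge_total G; exists e. Qed.

(** Otherwise the vertices reachable outside [X] have priority 0 and, joined to [X], form an arena.
    The dichotomy outside the attractor of [X] either enlarges [X] or gives Player 2 a set [Y]
    contradicting [sigma1_unrefuted]. *)
Lemma maximal_solvable_bad X h u :
  solvable X -> (forall Y : {set V}, X \proper Y -> ~ solvable Y) ->
  history h u -> u \notin X -> exists k, bad_within X k h u.
Proof.
move=> [s [tX winX cobX]] maxX hu uX; apply: contrapT => nobad.
pose Z := [set z | `[< exists h', reach X h u h' z >]]%SET.
have inZ h' z : reach X h u h' z -> z \in Z.
  by move=> rz; rewrite inE; apply/asboolP; exists h'.
have ZX z : z \in Z -> z \notin X.
  by rewrite inE => /asboolP[h' /reach_notin]; apply.
have Z0 z : z \in Z -> Omega1 z = 0%N.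
  rewrite inE => /asboolP[h' rz]; apply: contrapT => z0; apply: nobad.
  exact: (@reach_bad_within X h u h' z 0%N).
have moveZ h' z w : reach X h u h' z -> move h' z w -> w \in X :|: Z.
  move=> rz zw; rewrite inE; case: (boolP (w \in X)) => //= wX.
  by apply: inZ (reachS rz zw wX).
have [mX _] := winX.
(* From [Z], every move of the others is consistent with [sigma1], hence ends in [X] or in [Z]. *)
have tXZ : trap G true (X :|: Z) [set: V]%SET.
  move=> z w; rewrite finset.in_setU => /orP[zX|]; last rewrite inE => /asboolP[h' rz].
    by move=> nz wT zw; rewrite inE (tX z w).
  by move=> nz _ zw; apply: moveZ rz _; split.
have aXZ : arena G (X :|: Z).
  move=> z zXZ; split=> [|pz w zw]; last first.
    by apply: tXZ zXZ _ (finset.in_setT _) zw; apply: prob_not_player.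
  have [zPl|nz] := pselect (player G true z); last first.
    have [w zw] := edge_total G z; exists w => //.
    exact: tXZ zXZ nz (finset.in_setT _) zw.
  move: zXZ; rewrite finset.in_setU => /orP[zX|]; last rewrite inE => /asboolP[h' rz].
    by have [? ?] := mX z zX zPl; exists (s z); rewrite // inE; apply/orP; left.
  exists (sigma1 h' z); last exact: sigma1_strat.
  by apply: moveZ rz _; split=> //; apply: sigma1_strat.
have [A [r [sA [XA AXZ att aC tC]]]] :=
  attractor_exists true aXZ (finset.subsetUl X Z).
have uZ : u \in Z by apply: inZ (reach0 _ _ _).
have [[sC winC]|[Y [sY [/finset.set0Pn[y yY] YC tY winY]]]] :=
    parity_dichotomy Omega2 true aC.
  have tX' : trap G true X (X :|: Z) by move=> a b ? ? _; apply: tX; rewrite // finset.in_setT.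
  have winXZ := attractor_wins_trap aXZ XA AXZ att tX' winX winC.
  apply: (maxX (X :|: Z)).
    apply/properP; split; first exact: finset.subsetUl.
    by exists u => //; rewrite inE uZ orbT.
  (* A play that meets [X] has a tail governed by [s]; any other stays in [Z], where the priority is
     0. *)
  eexists; split; [exact: tXZ | exact: winXZ |] => rho rhoXZ binf.
  have [[n nX]|nX] := pselect (exists n, rho n \in X).
    apply: (cobX (tail n rho)).
      by apply: trap_play_in tX' mX rhoXZ _ nX => x ->.
    by apply/(tail_infinitely_often n (fun m => Omega1 (rho m) <> 0%N)).
  have [n _] := binf 0%N; apply; apply: Z0; have [+ _ _] := rhoXZ n.
  by rewrite inE => /orP[nnX|//]; case: nX; exists n.
have {tC}tY := trap_trans tY tC YC.
have YnX z : z \in Y -> z \notin X.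
  by move=> /(fintype.subsetP YC); rewrite inE => /andP[zA _];
    apply: contraNN zA => /(fintype.subsetP XA).
have : y \in Z.
  have /setDP[+ _] := fintype.subsetP YC y yY.
  by rewrite finset.in_setU (negbTE (YnX y yY)).
rewrite inE => /asboolP[h' ry].
(* From a consistent history ending at [y], Player 2 plays [sY] on [Y] and an arbitrary edge
   elsewhere. *)
have [e He] := edge_choice.
have [mY wY] := winY.
have [|rho [rhoF [rho0 rhoO] hrho yrho [rhotau rhowin]]] :=
    sigma1_unrefuted (tau := fun z => if z \in Y then sY z else e z)
      (history_reach hu ry).
  by move=> z z2; case: ifPn => // zY; have [] := mY z zY z2.
apply: (wins_parity_unique rhowin); apply: (@tail_wins_parity _ _ (size h')).
apply: wY; last exact: tail_fair.
(* Carrying [reach] along shows that Player 1's moves stay in [X :|: Z]; the trap then confines them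
   to [Y]. *)
have inY n : rho (size h' + n)%N \in Y /\
    reach X h u (Defs.prefix rho (size h' + n)) (rho (size h' + n)%N).
  elim: n => [|n [nY rn]]; first by rewrite addn0 yrho hrho.
  have [ne n1] := rhoO (size h' + n)%N; rewrite addnS.
  have mn : move (Defs.prefix rho (size h' + n)) (rho (size h' + n)%N)
      (rho (size h' + n).+1) by split.
  have wY' : rho (size h' + n).+1 \in Y.
    have [n2|n2] := pselect (player G false (rho (size h' + n)%N)).
      by rewrite rhotau ?leq_addr // nY; have [] := mY _ nY n2.
    exact: tY nY n2 (moveZ _ _ _ rn mn) ne.
  by split=> //; rewrite prefixS; apply: reachS mn _ => //; apply: YnX.
move=> n; rewrite /tail addnS; have [nY _] := inY n.
have [ne _] := rhoO (size h' + n)%N; split=> // n2.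
by rewrite rhotau ?leq_addr // nY.
Qed.

(** Otherwise every move from [u] enters [X], and [u] could be added, Player 1 playing there the
    move that [sigma1] makes after [h]. It lets a history go on outside [X] even from a bad
    vertex. *)
Lemma maximal_solvable_move X h u :
  solvable X -> (forall Y : {set V}, X \proper Y -> ~ solvable Y) ->
  u \notin X -> exists2 w, move h u w & w \notin X.
Proof.
move=> [s [tX winX cobX]] maxX uX; apply: contrapT => nex.
have uall w : move h u w -> w \in X.
  by move=> uw; apply: contrapT => /negP wX; apply: nex; exists w.
have [mX wX] := winX.
apply: (maxX (u |: X)).
  apply/properP; split; first exact: finset.subsetUr.
  by exists u => //; rewrite !inE eqxx.
pose s' x := if x == u then sigma1 h u else s x.
have ss' : {in X, s =1 s'}.
  by move=> x xX; rewrite /s'; case: eqP => // xu; rewrite -xu xX in uX.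
have mu : own G u = Pl1 -> move h u (sigma1 h u).
  by move=> u1; split=> //; apply: sigma1_strat.
have tX' : trap G true (u |: X) [set: V]%SET.
  move=> x w; rewrite finset.in_setU1 => /orP[/eqP-> n1 _ uw|xX n1 wT xw].
    by rewrite !inE uall ?orbT.
  by rewrite !inE (tX x w) ?orbT.
have tail_in rho : play_in G true (u |: X) s' rho ->
    play_in G true X s (tail 1 rho).
  move=> rhoX; have [r0 ne n1] := rhoX 0%N.
  apply: (trap_play_in (Y := u |: X) _ mX rhoX ss').
    by move=> a b ? ? _; apply: tX; rewrite // finset.in_setT.
  move: r0; rewrite finset.in_setU1 => /orP[/eqP r0|r0].
    rewrite r0 in ne n1; apply: uall; split=> // u1.
    by rewrite n1 // /s' eqxx.
  have [p|np] := pselect (player G true (rho 0%N)).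
    by rewrite n1 // -ss' //; have [] := mX _ r0 p.
  exact: tX r0 np (finset.in_setT _) ne.
exists s'; split=> //.
  split=> [x|rho /tail_in rhoX rhoF].
    rewrite finset.in_setU1 => /orP[/eqP-> u1|xX x1].
      by rewrite /s' eqxx !inE; have mv := mu u1; have [? _] := mv; rewrite uall ?orbT.
    by rewrite -ss' // !inE; have [? ->] := mX x xX x1; rewrite orbT.
  by apply: (@tail_wins_parity _ _ 1); apply: wX => //; apply: tail_fair.
move=> rho /tail_in /cobX + binf; apply.
by apply/(tail_infinitely_often 1 (fun m => Omega1 (rho m) <> 0%N)).
Qed.

(** Outside [X], always reduce the distance [rk] to the bad priority; at distance 0 move to any
    vertex outside [X] and start again. *)
Lemma maximal_solvable_outcome X :
  solvable X -> (forall Y : {set V}, X \proper Y -> ~ solvable Y) ->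
  v \notin X ->
  exists2 rho, Out G v sigma1 rho & infinitely_often (fun n => Omega1 (rho n) <> 0%N).
Proof.
move=> solX maxX vX.
pose good (st : seq V * V) := history st.1 st.2 /\ st.2 \notin X.
have /choice[rk Hrk] : forall st, exists k, good st ->
    bad_within X k st.1 st.2 /\ forall j, bad_within X j st.1 st.2 -> (k <= j)%N.
  move=> st; have [[hst stX]|] := pselect (good st); last by exists 0%N.
  have [k0 k0b] := maximal_solvable_bad solX maxX hst stX.
  have ex : exists k, `[< bad_within X k st.1 st.2 >] by exists k0; apply/asboolP.
  exists (ex_minn ex) => _; case: ex_minnP => k /asboolP kb kmin.
  by split=> // j jb; apply: kmin; apply/asboolP.
have /choice[f Hf] : forall st, exists w, good st ->
    [/\ move st.1 st.2 w, w \notin X &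
        Omega1 st.2 <> 0%N \/ (rk (rcons st.1 st.2, w) < rk st)%N].
  move=> st; have [gst|] := pselect (good st); last by exists v.
  have [hst stX] := gst; have [] := Hrk st gst.
  case E: (rk st) => [|k] /=.
    move=> bad _; have [w mw wX] := maximal_solvable_move st.1 solX maxX stX.
    by exists w => _; split=> //; left.
  move=> [w [mw wX kw]] _; exists w => _; split=> //; right.
  have [] := Hrk (rcons st.1 st.2, w); last by move=> _ /(_ k kw).
  by split=> //=; apply: reachS mw _; rewrite // inE.
pose next st := (rcons st.1 st.2, f st).
pose st n := iter n next ([::], v).
pose rho : play V := fun n => (st n).2.
have stE n : (st n).1 = Defs.prefix rho n.
  by elim: n => // n IH; rewrite prefixS -IH.
have gst n : good (st n).
  elim: n => [|n gn]; first by split=> //; apply: reach0.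
  have [mw wX _] := Hf _ gn; have [hn _] := gn; split=> //=.
  by apply: reachS mw _; rewrite // inE.
exists rho.
  split=> // n; have [[ne n1] _ _] := Hf _ (gst n); split=> // /n1.
  by rewrite -stE.
move=> N; move En: (rk (st N)) => k.
elim/ltn_ind: k N En => k IH N En.
have [_ _ [bad|lt]] := Hf _ (gst N); first by exists N.
have [|n Nn bad] := IH _ _ N.+1 erefl; first by rewrite -En.
by exists n => //; apply: ltnW.
Qed.

(** The empty set is solvable, so a maximal solvable set exists. If [v] were outside it,
    [maximal_solvable_outcome] would refute sure winning. *)
Lemma sure_winning_solvable : (forall x, Omega1 x <= 1)%N ->
  sure_winning G sigma1 (Parity Omega1) v -> exists2 X, solvable X & v \in X.
Proof.
move=> O1 sure.
have [|X solX maxX] := @maximal_set_exists V solvable finset.set0.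
  exists id; split; first by move=> u w; rewrite inE.
    by split=> [u|rho /(_ 0%N)[]]; rewrite inE.
  by move=> rho /(_ 0%N)[]; rewrite inE.
exists X => //; apply: contrapT => /negP vX.
have [rho /sure[p [pe [pinf [N pN]]]] binf] := maximal_solvable_outcome solX maxX vX.
have [n _ np] := pinf 0%N; have [m /pN mp m1] := binf N.
have := O1 (rho n); move: pe; rewrite np; case: p {pinf pN} mp {np} => [|[|//]] //.
by rewrite leqn0 => /eqP.
Qed.

End SureCoBuchi.

(** * Existence of the induced measure *)

Section KernelMeasure.
Local Open Scope classical_set_scope.
Local Open Scope ring_scope.
Variables (R : realType) (V : finType) (kern : seq V -> V -> R) (wt : seq V -> R).
Hypothesis kern_ge0 : forall h x, 0 <= kern h x.
Hypothesis kern_sum1 : forall h, \sum_x kern h x = 1.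
Hypothesis wt_nil : wt [::] = 1.
Hypothesis wt_rcons : forall h x, wt (rcons h x) = wt h * kern h x.
Implicit Types (h : seq V) (x : V) (t : R).

Lemma kernel_wt_ge0 h : 0 <= wt h.
Proof.
by elim/last_ind: h => [|h x IH]; rewrite ?wt_nil ?wt_rcons ?mulr_ge0.
Qed.

Definition cumul h k := \sum_(y <- take k (enum V)) kern h y.

Lemma cumulS h x k : (k < #|V|)%N ->
  cumul h k.+1 = cumul h k + kern h (nth x (enum V) k).
Proof.
move=> kV; rewrite /cumul (take_nth x) -?cardE // -cats1 big_cat /=.
by rewrite big_seq1.
Qed.

Lemma cumul0 h : cumul h 0 = 0.
Proof. by rewrite /cumul take0 big_nil. Qed.

Lemma cumul_card h : cumul h #|V| = 1.
Proof. by rewrite /cumul cardE take_size big_enum kern_sum1. Qed.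

Lemma cumul_le h j k : (j <= k)%N -> cumul h j <= cumul h k.
Proof.
move=> jk; rewrite /cumul -(cat_take_drop j (take k (enum V))) take_takel //.
by rewrite big_cat lerDl sumr_ge0.
Qed.

(* The cylinder of h corresponds to the subinterval [lo h, lo h + wt h[ of
   [0, 1[; it is cut into consecutive pieces, one per successor. *)
Fixpoint lo_rev (r : seq V) : R :=
  if r is x :: r' then
    lo_rev r' + wt (rev r') * cumul (rev r') (index x (enum V))
  else 0.

Definition lo h := lo_rev (rev h).

Lemma lo_rcons h x : lo (rcons h x) = lo h + wt h * cumul h (index x (enum V)).
Proof. by rewrite /lo rev_rcons /= revK. Qed.

Definition slot h t := lo h <= t < lo h + wt h.

Lemma index_enum_ltn x : (index x (enum V) < #|V|)%N.
Proof. by rewrite cardE index_mem mem_enum. Qed.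

Lemma slot_rconsE h x t : slot (rcons h x) t =
  (lo h + wt h * cumul h (index x (enum V)) <= t <
   lo h + wt h * cumul h (index x (enum V)).+1).
Proof.
rewrite /slot lo_rcons wt_rcons (cumulS _ x) ?index_enum_ltn //.
by rewrite nth_index ?mem_enum // mulrDr addrA.
Qed.

Lemma slot_rcons h x t : slot (rcons h x) t -> slot h t.
Proof.
rewrite slot_rconsE => /andP[lt tl]; apply/andP; split.
  apply: le_trans lt; rewrite lerDl mulr_ge0 ?kernel_wt_ge0 //.
  by rewrite -(cumul0 h) cumul_le.
apply: lt_le_trans tl _; rewrite lerD2l -[leRHS]mulr1 ler_wpM2l ?kernel_wt_ge0 //.
by rewrite -(cumul_card h) cumul_le // index_enum_ltn.
Qed.

Lemma slot_rcons_inj h x y t : slot (rcons h x) t -> slot (rcons h y) t -> x = y.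
Proof.
wlog xy : x y / (index x (enum V) <= index y (enum V))%N.
  by move=> W; case: (leqP (index x (enum V)) (index y (enum V))) => [|/ltnW] xy;
    [|move=> sx sy; apply/esym]; apply: W.
move: xy; rewrite leq_eqVlt => /orP[/eqP xy _ _|xy].
  by rewrite -(nth_index x (s := enum V) (x := x)) ?mem_enum // xy nth_index ?mem_enum.
rewrite !slot_rconsE => /andP[_ tx] /andP[yt _].
suff : t < t by rewrite ltxx.
apply: lt_le_trans tx (le_trans _ yt).
by rewrite lerD2l ler_wpM2l ?kernel_wt_ge0 // cumul_le.
Qed.

(** Since the last partial sum is 1, some piece is the first whose right end exceeds [t]. *)
Lemma slot_choice h t : slot h t -> exists x, slot (rcons h x) t.
Proof.
move=> /andP[lt tl].
have : t < lo h + wt h * cumul h #|V| by rewrite cumul_card mulr1.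
have : (#|V| <= #|V|)%N by [].
elim: {1 3}#|V| => [|k IH] kV tk.
  by move: tk; rewrite cumul0 mulr0 addr0 ltNge lt.
have [tk'|kt] := ltP t (lo h + wt h * cumul h k); first exact: IH (ltnW kV) tk'.
have /card_gt0P[x0 _] := leq_ltn_trans (leq0n k) kV.
exists (nth x0 (enum V) k).
by rewrite slot_rconsE index_uniq ?enum_uniq -?cardE // kt.
Qed.

(** The play coded by [t] follows the nested slots containing [t], which are unique at each
    length. *)
Lemma kernel_code_exists : exists f : R -> play V,
  forall t h, 0 <= t < 1 -> cylinder h (f t) <-> slot h t.
Proof.
(* [V] is inhabited, as a sum over an empty type could not be 1. *)
have [x0|V0] := pselect (exists x0 : V, True); last first.
  have := kern_sum1 [::]; rewrite big1 => [/eqP|x]; last by case: V0; exists x.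
  by rewrite eq_sym oner_eq0.
have [{}x0 _] := x0.
have /choice[g Hg] : forall th : R * seq V, exists x,
    slot th.2 th.1 -> slot (rcons th.2 x) th.1.
  move=> [t h] /=; have [/slot_choice[x sx]|] := boolP (slot h t); first by exists x.
  by exists x0.
pose st t n := iter n (fun h => rcons h (g (t, h))) [::].
pose f t : play V := fun n => g (t, st t n).
have size_st t n : size (st t n) = n by elim: n => //= n IH; rewrite size_rcons IH.
have slot_st t n : 0 <= t < 1 -> slot (st t n) t.
  move=> t01; elim: n => [|n IH]; last exact: (Hg (t, st t n)).
  by rewrite /slot /lo /= wt_nil add0r.
have cyl_st t h : cylinder h (f t) <-> st t (size h) = h.
  elim/last_ind: h => [|h x [IH1 IH2]]; first by split.
  rewrite size_rcons /=; split=> [cyl|/rcons_inj[eh ex]].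
    have hst : st t (size h) = h.
      apply: IH1 => i ih; have := cyl i.
      by rewrite size_rcons nth_rcons ih; apply; apply: ltnW.
    rewrite hst; congr rcons.
    have := cyl (size h); rewrite size_rcons ltnSn nth_rcons ltnn eqxx.
    by rewrite /f hst => ->.
  move=> i; rewrite size_rcons ltnS leq_eqVlt nth_rcons => /orP[/eqP->|ih].
    by rewrite ltnn eqxx.
  by rewrite ih; apply: IH2.
exists f => t h t01; rewrite cyl_st; split=> [<-|]; first exact: slot_st.
elim/last_ind: h => [|h x IH] sx //.
have hst := IH (slot_rcons sx).
rewrite size_rcons /= hst; congr rcons; apply: slot_rcons_inj sx.
by have := slot_st t (size h).+1 t01; rewrite /= hst.
Qed.

(** The image of Lebesgue measure on the unit interval under the coding: the preimage of the
    cylinder of [h] is an interval of length [wt h]. *)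
Lemma kernel_measure_exists : exists2 P : set (play V) -> \bar R,
  is_probability P & forall h, P (cylinder h) = (wt h)%:E.
Proof.
have [f Hf] := kernel_code_exists.
pose I : set R := [set` `[0, 1[%R].
have cylE h : I `&` f @^-1` cylinder h = [set` `[lo h, lo h + wt h[%R].
  apply/seteqP; split=> t /=; rewrite /I /= !in_itv /=; first by case=> t01 /Hf; apply.
  move=> sht; have t01 : 0 <= t < 1.
    elim/last_ind: h sht => [|h x IH /slot_rcons/IH//].
    by rewrite /lo /= wt_nil add0r.
  by split=> //; apply/Hf.
(* Sets with measurable preimage form a sigma-algebra containing the cylinders. *)
have mI A : <<s @cylinders V >> A -> measurable (I `&` f @^-1` A).
  apply: (smallest_sub (X := [set A | measurable (I `&` f @^-1` A)])).
    split=> [|B mB|F mF] /=.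
    - by rewrite preimage_set0 setI0; exact: measurable0.
    - rewrite setTD preimage_setC -setDE -[I `\` _]set0U -(setDv I) -setDIr.
      by apply: measurableD => //; exact: measurable_itv.
    - by rewrite preimage_bigcup setI_bigcupr; apply: bigcup_measurable => k _; exact: mF.
  by move=> _ [h _ <-] /=; rewrite cylE; exact: measurable_itv.
exists (fun A => lebesgue_measure (I `&` f @^-1` A)).
  split.
  - by rewrite preimage_set0 setI0 measure0.
  - by move=> A mA; exact: measure_ge0.
  - move=> F mF tF; rewrite preimage_bigcup setI_bigcupr.
    apply: measure_sigma_additive => [i|]; first exact: mI.
    by move=> i j _ _ [t [[_ ti] [_ tj]]]; apply: (tF i j) => //; exists (f t).
  rewrite preimage_setT setIT /I lebesgue_measure_itv /=.
  by rewrite lte_fin ltr01 oppr0 adde0.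
move=> h; rewrite cylE lebesgue_measure_itv /= lte_fin ltrDl.
have := kernel_wt_ge0 h; rewrite le_eqVlt => /orP[/eqP <-|h0].
  by rewrite ltxx.
by rewrite h0 -EFinB addrAC subrr add0r.
Qed.

End KernelMeasure.

(** * Almost every play is fair *)

Section Induced.
Local Open Scope classical_set_scope.
Local Open Scope ring_scope.
Variables (R : realType) (V : finType) (G : game R V) (v : V).
Variables (sigma1 sigma2 : strategy V).
Implicit Types (h : seq V) (x y : V) (rho : play V).

(** Here a history includes its last vertex, so [belast] and [last] recover the pair that strategies
    take; the empty history starts at [v]. *)
Definition kernel h x : R := if h is y :: h' then
  step_prob G sigma1 sigma2 (belast y h') (last y h') x else (x == v)%:R.

Lemma step_prob_ge0 h y x : 0 <= step_prob G sigma1 sigma2 h y x.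
Proof. by rewrite /step_prob; case E: (own G y) => //; apply: delta_ge0. Qed.

Lemma step_prob_sum1 h y : \sum_x step_prob G sigma1 sigma2 h y x = 1.
Proof.
have sum1 a : \sum_x (a == x)%:R = 1 :> R.
  rewrite (bigD1 a) //= eqxx big1 ?addr0 // => x.
  by rewrite eq_sym => /negbTE->.
by rewrite /step_prob; case E: (own G y) => //; apply: delta_sum1.
Qed.

Lemma kernel_ge0 h x : 0 <= kernel h x.
Proof. by case: h => // y h; apply: step_prob_ge0. Qed.

Lemma kernel_sum1 h : \sum_x kernel h x = 1.
Proof.
case: h => [|y h]; last exact: step_prob_sum1.
by rewrite (bigD1 v) //= eqxx big1 ?addr0 // => x /negbTE->.
Qed.

Lemma kernel_rcons h y x :
  kernel (rcons h y) x = step_prob G sigma1 sigma2 h y x.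
Proof. by case: h => //= a h; rewrite belast_rcons last_rcons. Qed.

Lemma path_prob_rcons h x : path_prob G v sigma1 sigma2 (rcons h x) =
  path_prob G v sigma1 sigma2 h * kernel h x.
Proof.
case: h => [|y h] /=; first by rewrite big_ord0 mulr1 mul1r.
rewrite size_rcons big_ord_recr /= mulrA; congr (_ * _ * _).
  apply: eq_bigr => i _; have ih := ltn_ord i.
  have -> : take i (y :: rcons h x) = take i (y :: h).
    by rewrite -rcons_cons -cats1 takel_cat //=; apply/ltnW/ltnW.
  by rewrite -[y :: rcons h x]rcons_cons nth_rcons /= nth_rcons ltnS ltnW // ih.
have -> : take (size h) (y :: rcons h x) = belast y h.
  by rewrite -rcons_cons lastI -!cats1 -catA -(size_belast y h) take_size_cat.
rewrite -[y :: rcons h x]rcons_cons nth_rcons /= ltnSn nth_rcons ltnn eqxx.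
by rewrite (nth_last y (y :: h)).
Qed.

Lemma induced_measure_exists : exists P, induced_measure G v sigma1 sigma2 P.
Proof.
have [P pP cP] := @kernel_measure_exists R V kernel
  (path_prob G v sigma1 sigma2) kernel_ge0 kernel_sum1 erefl path_prob_rcons.
by exists P.
Qed.

Definition pointed_play (x : V) := play V.
HB.instance Definition _ := Choice.on (pointed_play v).
HB.instance Definition _ := isPointed.Build (pointed_play v) (fun=> v).

Local Notation T := (g_sigma_algebraType (@cylinders V : set (set (pointed_play v)))).

Lemma measurable_cylinder h : measurable (cylinder h : set T).
Proof. by apply: sub_sigma_algebra; exists h. Qed.

(** Such a set is the finite union of the cylinders of length [n] that it contains. *)
Lemma measurable_prefix_closed n (A : set T) :
  (forall rho rho', (forall i, (i < n)%N -> rho i = rho' i) -> A rho -> A rho') ->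
  measurable A.
Proof.
move=> An.
have -> : A = \bigcup_(t in [set t : n.-tuple V | cylinder t `<=` A]) cylinder t.
  apply/seteqP; split=> [rho Arho|rho [t tA]]; last exact: tA.
  exists [tuple rho i | i < n] => [rho' rhoh|i].
    apply: An Arho => i ni; rewrite rhoh ?size_tuple //.
    by rewrite (nth_map (Ordinal ni)) ?size_enum_ord //= nth_enum_ord.
  rewrite size_tuple => ni.
  by rewrite (nth_map (Ordinal ni)) ?size_enum_ord //= nth_enum_ord.
by apply: fin_bigcup_measurable => // t _; exact: measurable_cylinder.
Qed.

Lemma measurable_ex (F : nat -> set T) : (forall n, measurable (F n)) ->
  measurable [set rho | exists n, F n rho].
Proof.
move=> mF; have -> : [set rho | exists n, F n rho] = \bigcup_n F n.
  by apply/seteqP; split=> rho [n]; [exists n | move=> _; exists n].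
exact: bigcupT_measurable.
Qed.

Lemma measurable_all (F : nat -> set T) : (forall n, measurable (F n)) ->
  measurable [set rho | forall n, F n rho].
Proof.
move=> mF; have -> : [set rho | forall n, F n rho] = \bigcap_n F n.
  by apply/seteqP; split=> rho H n => [_|]; apply: H.
exact: bigcapT_measurable.
Qed.

Lemma measurable_infinitely_often (F : nat -> set T) :
  (forall n, measurable (F n)) ->
  measurable [set rho | infinitely_often (fun n => F n rho)].
Proof.
move=> mF; apply: (@measurable_all (fun N => [set rho | exists2 n, (N <= n)%N & F n rho])).
move=> N; have -> : [set rho | exists2 n, (N <= n)%N & F n rho] =
    \bigcup_(n in [set n | (N <= n)%N]) F n.
  by apply/seteqP; split=> rho [n]; exists n.
exact: bigcup_measurable.
Qed.

Lemma measurable_eventually (F : nat -> set T) :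
  (forall n, measurable (F n)) ->
  measurable [set rho | exists N, forall n, (N <= n)%N -> F n rho].
Proof.
move=> mF; apply: (@measurable_ex (fun N => [set rho | forall n, (N <= n)%N -> F n rho])).
move=> N; have -> : [set rho | forall n, (N <= n)%N -> F n rho] =
    \bigcap_(n in [set n | (N <= n)%N]) F n.
  by apply/seteqP; split=> rho H n; apply: H.
by apply: bigcap_measurable => //; exists N => /=.
Qed.

Lemma measurable_Parity Omega : measurable (Parity Omega : set T).
Proof.
apply: (@measurable_ex (fun p => [set rho | ~~ odd p /\
   (infinitely_often (fun n => Omega (rho n) = p) /\
    exists N, forall n, (N <= n)%N -> (Omega (rho n) <= p)%N)])) => p.
have [op|op] := boolP (odd p).
  rewrite (_ : [set _ | _] = set0); first exact: measurable0.
  by apply/seteqP; split=> rho // [].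
have mO (Q : V -> Prop) n : measurable ([set rho | Q (rho n)] : set T).
  by apply: (@measurable_prefix_closed n.+1) => rho rho' e; rewrite /= e.
rewrite (_ : [set _ | _] =
  [set rho | infinitely_often (fun n => Omega (rho n) = p)] `&`
  [set rho | exists N, forall n, (N <= n)%N -> (Omega (rho n) <= p)%N]); last first.
  by apply/seteqP; split=> rho; [case=> _ | split].
apply: measurableI.
  by apply: (@measurable_infinitely_often (fun n => [set rho | Omega (rho n) = p]))
    => n; apply: (mO (fun x => Omega x = p)).
by apply: (@measurable_eventually (fun n => [set rho | (Omega (rho n) <= p)%N]))
  => n; apply: (mO (fun x => (Omega x <= p)%N)).
Qed.

Variable P : set (play V) -> \bar R.
Hypothesis P_induced : induced_measure G v sigma1 sigma2 P.

(* Changing the junk values of P outside the sigma-algebra makes it a measure. *)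
Definition play_measure (A : set T) : \bar R :=
  if `[< measurable A >] then P A else 0%E.

Lemma play_measureE (A : set T) : measurable A -> play_measure A = P A.
Proof. by move=> mA; rewrite /play_measure asboolT. Qed.

Lemma play_measure0 : play_measure set0 = 0%E.
Proof. by case: P_induced => -[P0 _ _ _] _; rewrite play_measureE. Qed.

Lemma play_measure_ge0 (A : set T) : (0 <= play_measure A)%E.
Proof.
rewrite /play_measure; case: ifPn => // /asboolP mA.
by case: P_induced => -[_ + _ _] _; apply.
Qed.

Lemma play_measure_sigma_additive : semi_sigma_additive play_measure.
Proof.
move=> F mF tF mUF; rewrite play_measureE //.
under eq_cvg do under eq_bigr do rewrite play_measureE //.
by case: P_induced => -[_ _ + _] _; apply.
Qed.

HB.instance Definition _ := isMeasure.Build _ T R play_measure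
  play_measure0 play_measure_ge0 play_measure_sigma_additive.

Local Notation mu := (play_measure : {measure set T -> \bar R}).
Local Notation pp := (path_prob G v sigma1 sigma2).

Lemma play_measure_cylinder h : mu (cylinder h) = (pp h)%:E.
Proof.
have -> : mu (cylinder h) = P (cylinder h).
  by apply: play_measureE; exact: measurable_cylinder.
by case: P_induced => _ ->.
Qed.

Lemma path_prob_ge0 h : 0 <= pp h.
Proof. by rewrite -lee_fin -play_measure_cylinder; exact: measure_ge0. Qed.

Lemma measure_le_sum (A : set T) (F : V -> set T) :
  measurable A -> (forall x, measurable (F x)) ->
  (forall rho, A rho -> exists x, F x rho) -> (mu A <= \sum_x mu (F x))%E.
Proof.
move=> mA mF AF.
have [mU leU] : measurable (\big[setU/set0]_x F x) /\
    (mu (\big[setU/set0]_x F x) <= \sum_x mu (F x))%E.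
  elim/big_rec2: _ => [|x S B _ [mB leB]]; first by rewrite measure0.
  split; first exact: measurableU.
  by apply: le_trans (measureU2 _ _ _) _ => //; rewrite leeD2l.
apply: le_trans leU; apply: le_measure; rewrite ?inE // => rho /AF[x Fx].
by rewrite (bigD1 x) //=; left.
Qed.

(** * Plays that never take a given probabilistic edge *)

Section Avoid.
Variables (u w : V).
Hypothesis u_prob : own G u = Prob.

(* Between times n and n + m the vertex u is visited at least k times and is
   never left to w. *)
Fixpoint avoids m k n rho : Prop :=
  if m is m'.+1 then
    (rho n = u -> rho n.+1 <> w) /\ avoids m' (k - (rho n == u))%N n.+1 rho
  else k = 0%N.

Lemma measurable_avoids m k n : measurable ([set rho | avoids m k n rho] : set T).
Proof.
apply: (@measurable_prefix_closed (n + m).+1) => rho rho' /=.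
elim: m k n => //= m IH k n e [nuw av].
have <- : rho n = rho' n by apply: e; lia.
have <- : rho n.+1 = rho' n.+1 by apply: e; lia.
by split=> //; apply: IH av => i im; apply: e; lia.
Qed.

Lemma delta_compl : \sum_(x | x != w) delta G u x = 1 - delta G u w.
Proof. by rewrite -(delta_sum1 u_prob) [in RHS](bigD1 w) //= addrAC subrr add0r. Qed.

Lemma delta_compl_ge0 : 0 <= 1 - delta G u w.
Proof. by rewrite -delta_compl sumr_ge0 // => x _; apply: delta_ge0. Qed.

Lemma delta_compl_le1 : 1 - delta G u w <= 1.
Proof. by rewrite lerBlDl lerDr delta_ge0. Qed.

(** Each of the [k] visits to [u] costs a factor [1 - delta G u w]; induction on [m], splitting on
    the next vertex. *)
Lemma avoids_le m k h y :
  (mu (cylinder (rcons h y) `&` [set rho | avoids m k (size h) rho]) <=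
   ((1 - delta G u w) ^+ k * pp (rcons h y))%:E)%E.
Proof.
have q0 := delta_compl_ge0; have q1 := delta_compl_le1.
have mA l (j i : nat) g : measurable (cylinder g `&` [set rho | avoids l j i rho] : set T).
  by apply: measurableI; [exact: measurable_cylinder | exact: measurable_avoids].
elim: m k h y => [|m IH] k h y.
  case: k => [|k].
    rewrite expr0 mul1r -play_measure_cylinder.
    by apply: le_measure => [||rho []//]; rewrite inE //; exact: measurable_cylinder.
  rewrite (_ : _ `&` _ = set0); last by apply/seteqP; split=> rho // [].
  by rewrite measure0 lee_fin mulr_ge0 ?exprn_ge0 ?path_prob_ge0.
pose F x : set T := if (y == u) && (x == w) then set0 else
  cylinder (rcons (rcons h y) x) `&` [set rho | avoids m (k - (y == u))%N (size h).+1 rho].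
apply: le_trans (measure_le_sum (F := F) _ _ _) _.
- exact: mA.
- by move=> x; rewrite /F; case: ifP => // _; exact: mA.
- move=> rho [cyl [nuw av]]; exists (rho (size h).+1).
  have yE : rho (size h) = y.
    by have := cyl (size h); rewrite size_rcons nth_rcons ltnn eqxx; apply.
  rewrite yE in nuw av; rewrite /F; case: ifPn => [/andP[/eqP yu /eqP]|_].
    exact: nuw.
  split=> // i; rewrite size_rcons ltnS leq_eqVlt nth_rcons => /orP[/eqP->|ih].
    by rewrite ltnn eqxx size_rcons.
  by rewrite ih; apply: cyl.
pose q := 1 - delta G u w.
apply: (@le_trans _ _ (\sum_x (if (y == u) && (x == w) then 0 else
    q ^+ (k - (y == u))%N * (pp (rcons h y) * kernel (rcons h y) x))%:E)).
  apply: lee_sum => x _; rewrite /F; case: ifP => _; first by rewrite measure0.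
  by rewrite -path_prob_rcons; have := IH (k - (y == u))%N (rcons h y) x;
    rewrite size_rcons.
rewrite sumEFin lee_fin; have [->|yu] := eqVneq y u.
  under eq_bigr => x _ do rewrite /= -(if_neg (x == w)).
  rewrite -big_mkcond /= -!mulr_sumr.
  under eq_bigr => x _ do rewrite kernel_rcons /step_prob u_prob.
  rewrite delta_compl -/q (mulrC _ q) mulrA ler_wpM2r ?path_prob_ge0 //.
  (* Subtraction is truncated: for [k = 0] the spare factor is bounded by 1. *)
  case: (k) => [|j] /=; first by rewrite sub0n expr0 mul1r.
  by rewrite subSS subn0 exprSr.
by rewrite /= subn0 -!mulr_sumr kernel_sum1 mulr1.
Qed.

Lemma avoids_mono rho m m' k n :
  (forall i, (n <= i)%N -> rho i = u -> rho i.+1 <> w) ->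
  (m <= m')%N -> avoids m k n rho -> avoids m' k n rho.
Proof.
elim: m m' k n => [|m IH] m' k n never; last first.
  case: m' => // m' mm [nuw av]; split=> //; apply: IH av => // i ni.
  by apply: never; apply: ltnW.
move=> _ /= ->; elim: m' n never => //= m' IHm n never.
by rewrite sub0n; split; [exact: never | apply: IHm => i ni; apply/never/ltnW].
Qed.

(** Induction on [k], and inside it on the distance [d] to a later visit to [u]. *)
Lemma avoids_ex rho k n :
  (forall i, (n <= i)%N -> rho i = u -> rho i.+1 <> w) ->
  infinitely_often (fun i => rho i = u) -> exists m, avoids m k n rho.
Proof.
move=> never uinf; elim: k n never => [|k IHk] n never; first by exists 0%N.
have [N nN Nu] := uinf n.
move: (subnK nN); move: (N - n)%N => d.
elim: d n never {nN} => [|d IHd] n never nN.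
  have [|m av] := IHk n.+1; first by move=> i ni; apply/never/ltnW.
  exists m.+1; split; first exact: never.
  by rewrite -nN add0n in Nu; rewrite Nu eqxx subSS subn0.
have never' i : (n.+1 <= i)%N -> rho i = u -> rho i.+1 <> w.
  by move=> ni; apply/never/ltnW.
have [nu|nu] := eqVneq (rho n) u.
  have [m av] := IHk n.+1 never'; exists m.+1; split; first exact: never.
  by rewrite nu eqxx subSS subn0.
have [|m av] := IHd n.+1 never'; first by rewrite addnS -addSn.
by exists m.+1; split; [exact: never | rewrite (negbTE nu) subn0].
Qed.

Hypothesis uw : edge G u w.

(** Such plays visit [u] at least [k] times without taking the edge, for every [k], so their measure
    is below a geometric sequence; its ratio is less than 1 because the edge has positive
    probability. *)
Lemma unfair_negligible h y : mu.-negligible (cylinder (rcons h y) `&`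
  ([set rho | forall i, (size h <= i)%N -> rho i = u -> rho i.+1 <> w] `&`
   [set rho | infinitely_often (fun i => rho i = u)])).
Proof.
set A : set T := (X in negligible _ X); pose q : R := 1 - delta G u w.
set N : set T := [set rho | forall i, (size h <= i)%N -> rho i = u -> rho i.+1 <> w] in A *.
have mN : measurable N.
  rewrite (_ : N = \bigcap_(i in [set i | (size h <= i)%N])
      [set rho | rho i = u -> rho i.+1 <> w]); last by apply/seteqP; split.
  apply: bigcap_measurable => [|i _]; first by exists (size h) => /=.
  by apply: (@measurable_prefix_closed i.+2) => rho rho' e /=; rewrite !e.
have mA : measurable A.
  apply: measurableI; first exact: measurable_cylinder.
  apply: measurableI => //.
  apply: (@measurable_infinitely_often (fun i => [set rho | rho i = u])) => i.
  by apply: (@measurable_prefix_closed i.+1) => rho rho' e /=; rewrite !e.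
(* For fixed [k] the sets [F m] increase with [m] and cover [A], so the bound of [avoids_le] passes
   to the limit. *)
have leA k : (mu A <= (q ^+ k * pp (rcons h y))%:E)%E.
  pose F m : set T := N `&` (cylinder (rcons h y) `&` [set rho | avoids m k (size h) rho]).
  have mF m : measurable (F m).
    apply: measurableI => //; apply: measurableI; first exact: measurable_cylinder.
    exact: measurable_avoids.
  have mUF : measurable (\bigcup_m F m) by exact: bigcupT_measurable.
  have F_nd : {homo F : m n / (m <= n)%N >-> (m <= n)%O}.
    move=> m n mn; apply/subsetPset => rho [Nrho [cyl av]].
    by split=> //; split=> //; apply: avoids_mono av.
  apply: (@le_trans _ _ (mu (\bigcup_m F m))).
    apply: le_measure; rewrite ?inE // => rho [cyl [Nrho uinf]].
    by have [m av] := avoids_ex k Nrho uinf; exists m.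
  apply: (lee_cvg_to (nondecreasing_cvg_mu mF mUF F_nd) (cvg_cst _)).
  apply: nearW => m; apply: le_trans (avoids_le m k h y).
  apply: le_measure => [||rho []//]; rewrite inE //.
  apply: measurableI; first exact: measurable_cylinder.
  exact: measurable_avoids.
have q1 : `|q| < 1.
  rewrite ger0_norm ?delta_compl_ge0 // ltrBlDl ltrDr.
  by apply/(delta_supp w u_prob).
apply/negligibleP => //; apply/eqP; rewrite eq_le measure_ge0 andbT.
have cvg0 : (fun k => (q ^+ k * pp (rcons h y))%:E) @ \oo --> (0 * pp (rcons h y))%:E.
  by apply: cvg_EFin; [exact: nearW | apply: cvgMr_tmp; exact: cvg_expr].
rewrite -[leRHS](_ : (0 * pp (rcons h y))%:E = 0%E); last by rewrite mul0r.
by apply: (lee_cvg_to (cvg_cst (mu A)) cvg0); apply: nearW.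
Qed.

End Avoid.

Lemma negligible_bigcup_count (I : countType) (F : I -> set T) :
  (forall i, mu.-negligible (F i)) -> mu.-negligible (\bigcup_i F i).
Proof.
move=> nF.
apply: (@negligibleS _ _ _ mu
    (\bigcup_n (if unpickle n is Some i then F i else set0))).
  by move=> rho [i _ Fi]; exists (pickle i) => //; rewrite pickleK.
by apply: negligible_bigcup => n; case: unpickle => // ; exact: negligible_set0.
Qed.

(** Consistency with both strategies and with [delta], phrased so that its failure puts the play in
    one of countably many null cylinders. *)
Definition conforms rho := forall n, pp (Defs.prefix rho n) != 0.

Lemma prefix_cylinder rho n : cylinder (Defs.prefix rho n) rho.
Proof.
move=> i; rewrite /Defs.prefix size_map size_iota => ni.
by rewrite (nth_map 0%N) ?size_iota // nth_iota.
Qed.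

(** An unfair play has a finite prefix after which some edge of a recurring probabilistic vertex is
    never taken; there are countably many choices of prefix and edge. *)
Lemma conforms_fair_ae :
  mu.-negligible (~` [set rho | conforms rho /\ fair G rho]).
Proof.
pose F1 h : set T := if pp h == 0 then cylinder h else set0.
pose F2 (c : V * V * (seq V * V)) : set T :=
  let: (u, w, (h, y)) := c in
  if `[< own G u = Prob /\ edge G u w >] then cylinder (rcons h y) `&`
  ([set rho | forall i, (size h <= i)%N -> rho i = u -> rho i.+1 <> w] `&`
   [set rho | infinitely_often (fun i => rho i = u)]) else set0.
apply: (@negligibleS _ _ _ mu ((\bigcup_h F1 h) `|` (\bigcup_c F2 c))).
  move=> rho; apply: contra_notP => nF; split=> [n|u w uP uw uinf].
    apply: contra_notN nF => p0; left; exists (Defs.prefix rho n) => //.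
    by rewrite /F1 p0; exact: prefix_cylinder.
  move=> N; apply: contrapT => nex; apply: nF; right.
  exists (u, w, (Defs.prefix rho N, rho N)) => //=.
  rewrite asboolT // -prefixS; split; first exact: prefix_cylinder.
  split=> //= i; rewrite /Defs.prefix size_map size_iota => Ni iu iw.
  by apply: nex; exists i.
apply: negligibleU; apply: negligible_bigcup_count.
  move=> h; rewrite /F1; case: ifPn => [/eqP h0|_]; last exact: negligible_set0.
  apply/negligibleP; first exact: measurable_cylinder.
  by have := play_measure_cylinder h; rewrite h0.
move=> [[u w] [h y]] /=; case: ifPn => [/asboolP[uP uw]|_]; last exact: negligible_set0.
exact: unfair_negligible.
Qed.

Lemma conforms_fair_null (A : set T) : measurable A ->
  (forall rho, A rho -> conforms rho -> fair G rho -> False) -> mu A = 0%E.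
Proof.
move=> mA nA; apply: measure_negligible => //.
by apply: negligibleS conforms_fair_ae => rho Arho [/= ? ?]; apply: (nA rho).
Qed.

Lemma play_measureC (A : set T) : measurable A -> (mu A + mu (~` A) = 1)%E.
Proof.
move=> mA; rewrite -measureU //; last by rewrite setICr.
  rewrite setUCr; case: P_induced => -[_ _ _ <-] _.
  exact: play_measureE.
exact: measurableC.
Qed.

Lemma induced_almost_sure Omega :
  (forall rho, conforms rho -> fair G rho -> Parity Omega rho) ->
  P (Parity Omega) = 1%E.
Proof.
move=> H; have mO := measurable_Parity Omega.
have C0 : mu (~` Parity Omega) = 0%E.
  apply: conforms_fair_null => [|rho nO /H HO /HO//]; exact: measurableC.
by rewrite -(play_measureC mO) C0 adde0; apply/esym; exact: play_measureE.
Qed.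

(** The losing plays and the unfair or nonconforming ones are null, so they cannot fill a cylinder
    of positive measure. *)
Lemma induced_positive Omega h : P (Parity Omega) = 1%E -> 0 < pp h ->
  exists rho, [/\ cylinder h rho, conforms rho, fair G rho & Parity Omega rho].
Proof.
move=> P1 h0; pose A : set T := cylinder h; pose B : set T := Parity Omega.
have mB : measurable B by exact: measurable_Parity.
have mA : measurable A by exact: measurable_cylinder.
have mC : measurable (~` B) by exact: measurableC.
apply: contrapT => nex.
have C0 : mu (~` B) = 0%E.
  have B1 : mu B = 1%E by rewrite -P1; exact: play_measureE.
  by rewrite -[LHS]add0e -(subee (x := 1%E)) // addeAC -B1 play_measureC // B1.
have AB0 : mu (A `&` B) = 0%E.
  apply: conforms_fair_null => [|rho [hrho Orho] crho frho]; first exact: measurableI.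
  by apply: nex; exists rho.
have : (mu A <= mu (A `&` B) + mu (~` B))%E.
  apply: le_trans (measureU2 _ (measurableI _ _ mA mB) mC).
  apply: le_measure; rewrite ?inE //; first by apply: measurableU => //; exact: measurableI.
  by move=> rho Arho; have [rB|rB] := pselect (B rho); [left | right].
by rewrite AB0 C0 adde0 play_measure_cylinder lee_fin leNgt h0.
Qed.

Lemma conforms_start rho : conforms rho -> rho 0%N = v.
Proof.
by move=> /(_ 1%N) /=; rewrite big_ord0 mulr1 pnatr_eq0 eqb0 negbK => /eqP.
Qed.

Lemma conforms_step rho n : conforms rho ->
  step_prob G sigma1 sigma2 (Defs.prefix rho n) (rho n) (rho n.+1) != 0.
Proof.
move=> /(_ n.+2); rewrite prefixS path_prob_rcons prefixS kernel_rcons.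
by rewrite mulf_eq0 negb_or => /andP[].
Qed.

Lemma conforms_Pl1 rho n : conforms rho -> own G (rho n) = Pl1 ->
  rho n.+1 = sigma1 (Defs.prefix rho n) (rho n).
Proof.
move=> /conforms_step-/(_ n) + n1; rewrite /step_prob n1.
by rewrite pnatr_eq0 eqb0 negbK => /eqP.
Qed.

Lemma conforms_Pl2 rho n : conforms rho -> own G (rho n) = Pl2 ->
  rho n.+1 = sigma2 (Defs.prefix rho n) (rho n).
Proof.
move=> /conforms_step-/(_ n) + n2; rewrite /step_prob n2.
by rewrite pnatr_eq0 eqb0 negbK => /eqP.
Qed.

Lemma conforms_edge rho n : is_strategy G Pl1 sigma1 -> is_strategy G Pl2 sigma2 ->
  conforms rho -> edge G (rho n) (rho n.+1).
Proof.
move=> s1 s2 crho; case E: (own G (rho n)).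
- by rewrite conforms_Pl1 //; apply: s1.
- by rewrite conforms_Pl2 //; apply: s2.
apply/(delta_supp _ E); rewrite lt_def delta_ge0 // andbT.
by have := conforms_step n crho; rewrite /step_prob E.
Qed.

End Induced.

(** * Refuting almost-sure winning after a consistent history *)

Section Refutation.
Local Open Scope ring_scope.
Variables (R : realType) (V : finType) (G : game R V) (v : V).
Variables (sigma1 : strategy V) (tau : V -> V).
Hypothesis sigma1_strat : is_strategy G Pl1 sigma1.
Hypothesis tau_edge : forall u, own G u = Pl2 -> edge G u (tau u).

(** After [(h, u)] the next vertex has index [(size h).+1]. Only the time is compared with [g]; the
    edge test keeps the strategy legal off [g]. *)
Definition follow_then (g : seq V) : strategy V := fun h u =>
  let w := nth u g (size h).+1 in
  if ((size h).+1 < size g)%N && edge G u w then w else tau u.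

Lemma follow_then_strategy g : is_strategy G Pl2 (follow_then g).
Proof. by move=> h u u2; rewrite /follow_then; case: ifP => [/andP[]|_]; auto. Qed.

(** The extension [e] lets the path shrink in the induction while the list that Player 2 follows
    stays fixed. *)
Lemma path_prob_history h u e :
  history G v sigma1 h u ->
  0 < path_prob G v sigma1 (follow_then (rcons h u ++ e)) (rcons h u).
Proof.
move=> hu; elim: hu e => {h u}[|h u w _ IH [uw u1] _] e.
  by rewrite /= eqxx big_ord0 mulr1.
rewrite path_prob_rcons kernel_rcons mulr_gt0 //.
  by rewrite [rcons (rcons _ _) w ++ e]cat_rcons; apply: IH.
rewrite /step_prob; case E: (own G u).
- by rewrite (u1 E) eqxx.
- have nthE : nth u (rcons (rcons h u) w ++ e) (size h).+1 = w.
    by rewrite nth_cat !size_rcons ltnSn nth_rcons size_rcons ltnn eqxx.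
  rewrite /follow_then nthE uw andbT size_cat !size_rcons ifT ?eqxx //.
  exact: leq_addr.
- exact/(delta_supp w E).
Qed.

(** Player 2 follows [rcons h y], which has positive probability, then plays [tau];
    [induced_positive] supplies the play. *)
Lemma almost_sure_unrefuted_by Omega h y :
  almost_sure_winning G sigma1 (Parity Omega) v -> history G v sigma1 h y ->
  exists rho, [/\ fair G rho, Out G v sigma1 rho, Defs.prefix rho (size h) = h,
    rho (size h) = y & (forall n, (size h <= n)%N -> own G (rho n) = Pl2 ->
       rho n.+1 = tau (rho n)) /\ wins_parity Omega true rho].
Proof.
move=> as1 hy; set s2 := follow_then (rcons h y).
have s2_strat : is_strategy G Pl2 s2 := follow_then_strategy (rcons h y).
have [P indP] := induced_measure_exists G v sigma1 s2.
have hpos : 0 < path_prob G v sigma1 s2 (rcons h y).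
  by have := path_prob_history [::] hy; rewrite cats0.
have [rho [cyl crho frho Orho]] := induced_positive indP (as1 _ s2_strat P indP) hpos.
exists rho; split=> //.
- split; first exact: conforms_start crho.
  by move=> n; split; [exact: conforms_edge crho | exact: conforms_Pl1 crho].
- apply: (@eq_from_nth _ y); rewrite /Defs.prefix size_map size_iota // => i ih.
  rewrite (nth_map 0%N) ?size_iota // nth_iota // add0n.
  have := cyl i; rewrite size_rcons nth_rcons ih => -> //; last exact: ltnW.
  exact: set_nth_default.
- by have := cyl (size h); rewrite size_rcons nth_rcons ltnn eqxx; apply.
split; last exact/wins_parity_true.
(* From time [size h] on the list is exhausted, so [tau] decides. *)
move=> n hn n2; rewrite (conforms_Pl2 crho n2) /s2 /follow_then.
by rewrite size_rcons /Defs.prefix size_map size_iota ltnS ltnNge hn.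
Qed.

End Refutation.

(** * The memoryless strategy obtained from a solvable set *)

Theorem theorem7 (R : realType) (V : finType) (G : game R V)
    (Omega1 Omega2 : V -> nat) (v : V) :
  (forall x, (Omega1 x <= 1)%N) ->
  (exists sigma1 : strategy V, is_strategy G Pl1 sigma1 /\
     sure_winning G sigma1 (Parity Omega1) v /\
     almost_sure_winning G sigma1 (Parity Omega2) v) ->
  exists sigma1 : strategy V, is_strategy G Pl1 sigma1 /\
     memoryless G Pl1 sigma1 /\
     sure_winning G sigma1 (Parity Omega1) v /\
     almost_sure_winning G sigma1 (Parity Omega2) v.
Proof.
move=> O1 [sigma1 [s1 [sure as1]]].
have unref : unrefuted G Omega2 v sigma1.
  by move=> h y tau hy tauE; exact: (almost_sure_unrefuted_by s1 tauE as1 hy).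
have [X [s [tX [mX wX] cobX]] vX] := sure_winning_solvable s1 unref O1 sure.
have [e He] := edge_choice G.
(* Outside [X] any edge serves, since plays from [v] never leave [X]. *)
pose sigma : strategy V := fun _ u => if u \in X then s u else e u.
have sigma_strat : is_strategy G Pl1 sigma.
  by move=> h u u1; rewrite /sigma; case: ifPn => // uX; have [] := mX u uX u1.
have inX rho : rho 0%N = v -> (forall n, edge G (rho n) (rho n.+1) /\
    (own G (rho n) = Pl1 -> rho n.+1 = sigma (Defs.prefix rho n) (rho n))) ->
    play_in G true X s rho.
  move=> rho0 rhoO.
  have inX n : rho n \in X.
    elim: n => [|n nX]; first by rewrite rho0.
    have [ne n1] := rhoO n.
    have [p|np] := pselect (player G true (rho n)).
      by rewrite n1 // /sigma nX; have [] := mX _ nX p.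
    exact: tX nX np (finset.in_setT _) ne.
  by move=> n; have [ne n1] := rhoO n; split=> // /n1; rewrite /sigma inX.
exists sigma; split=> //; split; first by [].
split=> [rho [rho0 rhoO]|sigma2 s2 P indP].
  have [N HN] := not_infinitely_often (cobX rho (inX rho rho0 rhoO)).
  have O0 n : (N <= n)%N -> Omega1 (rho n) = 0%N.
    by move=> /HN; case: (Omega1 _) => // k [].
  exists 0%N; split=> //; split; last by exists N => n /O0 ->.
  by move=> M; exists (maxn N M); [exact: leq_maxr | rewrite O0 ?leq_maxl].
apply: (induced_almost_sure indP) => rho crho frho.
apply/wins_parity_true; apply: wX => //; apply: inX; first exact: conforms_start crho.
by move=> n; split; [exact: conforms_edge crho | exact: conforms_Pl1 crho].
Qed.
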